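(* For all integers $n_1,n_2,n_3\ge 1$, $$\operatorname{cr}(K_{n_1,n_2,n_3})\le\overline{\operatorname{cr}}(K_{n_1,n_2,n_3})\le A(n_1,n_2,n_3),$$ where $$A(n_1,n_2,n_3)=\sum_{\substack{i=1,2,3\\ \{j,k\}=\{1,2,3\}\setminus \{i\}}}\left(\left\lfloor \frac{n_j}{2}\right\rfloor \left\lfloor \frac{n_j-1}{2}\right\rfloor \left\lfloor \frac{n_k}{2}\right\rfloor \left\lfloor \frac{n_k-1}{2}\right\rfloor +\left\lfloor \frac{n_i}{2}\right\rfloor \left\lfloor \frac{n_i-1}{2}\right\rfloor \left\lfloor \frac{n_j n_k}{2}\right\rfloor \right).$$
   Context: $K_{n_1,n_2,n_3}$ is the complete tripartite graph with partite sets of sizes $n_1,n_2,n_3$. The sum defining $A$ has three terms, one for each $i\in\{1,2,3\}$, with $j,k$ the two remaining indices (each unordered pair $\{j,k\}$ counted once). A plane drawing of a graph is a good drawing if no more than two edges intersect at any point that is not a vertex, edges incident with a common vertex do not cross, no pair of edges cross more than once, and edges that intersect at a non-vertex must cross. The crossing number $\operatorname{cr}(D)$ of a good drawing $D$ is the number of non-vertex edge intersections in $D$. The crossing number of a graph $G$ is $\operatorname{cr}(G)=\min\{\operatorname{cr}(D): D \text{ is a good drawing of } G\}$. A good drawing is rectilinear if every edge is drawn as a straight line segment, and the rectilinear crossing number $\overline{\operatorname{cr}}(G)$ is the minimum of $\operatorname{cr}(D)$ over all rectilinear good drawings $D$ of $G$. *)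

(* Defs.v *)
From HB Require Import structures.
From mathcomp Require Import all_boot all_order all_algebra.
From mathcomp Require Import all_classical all_reals all_analysis.

Set Implicit Arguments.
Unset Strict Implicit.
Unset Printing Implicit Defensive.

Import Order.TTheory GRing.Theory Num.Theory.
Import numFieldNormedType.Exports.

Record sgraph := SGraph {
  vertex :> finType;
  adj : rel vertex;
  adj_sym : symmetric adj;
  adj_irrefl : irreflexive adj }.

Definition edges (G : sgraph) : {set {set G}} :=
  [set [set p.1; p.2] | p : G * G & adj p.1 p.2]%SET.

Section CompleteTripartite.
Variables n1 n2 n3 : nat.

Definition tripartite_vertex : finType := ('I_n1 + 'I_n2 + 'I_n3)%type.

Definition part (x : tripartite_vertex) : 'I_3 :=
  match x with
  | inl (inl _) => inord 0
  | inl (inr _) => inord 1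
  | inr _ => inord 2
  end.

Definition tripartite_adj : rel tripartite_vertex :=
  fun x y => part x != part y.

Lemma tripartite_adj_sym : symmetric tripartite_adj.
Proof. by move=> x y; rewrite /tripartite_adj eq_sym. Qed.

Lemma tripartite_adj_irrefl : irreflexive tripartite_adj.
Proof. by move=> x; rewrite /tripartite_adj eqxx. Qed.

Definition complete_tripartite : sgraph :=
  SGraph tripartite_adj_sym tripartite_adj_irrefl.

End CompleteTripartite.

Local Open Scope classical_set_scope.
Local Open Scope ring_scope.

Section Plane.
Variable R : realType.
Local Notation plane := (R * R)%type.

Definition simple_arc (A : set plane) (p q : plane) : Prop :=
  exists gamma : R -> plane,
    [/\ {within `[0, 1], continuous gamma},
        set_inj `[0, 1] gamma,
        gamma 0 = p,
        gamma 1 = q &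
        gamma @` `[0, 1] = A].

Definition segment (p q : plane) : set plane :=
  [set (1 - t) *: p + t *: q | t in `[0, 1]].

(* [A] and [B] cross (rather than touch) at [p]: some homeomorphism [h] from  *)
(* an open neighbourhood [U] of [p] onto an open neighbourhood of the origin  *)
(* carries [A] and [B] to the horizontal and the vertical coordinate axes.    *)
(* "Homeomorphism onto an open set" is stated as injective, continuous, open. *)
Definition crosses_at (A B : set plane) (p : plane) : Prop :=
  exists (U : set plane) (h : plane -> plane),
    [/\ open U /\ U p,
        h p = (0, 0),
        [/\ set_inj U h,
            {in U, continuous h} &
            forall W, W `<=` U -> open W -> open (h @` W)],
        (forall q, U q -> (A q <-> (h q).2 = 0)) &
        (forall q, U q -> (B q <-> (h q).1 = 0))].

End Plane.

(* [curve] is only meaningful on [edges G]. *)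
Record drawing (R : realType) (G : sgraph) := Drawing {
  pos : G -> R * R;
  curve : {set G} -> set (R * R);
  pos_inj : injective pos;
  curve_arc : forall u v : G, adj u v ->
    simple_arc (curve [set u; v]%SET) (pos u) (pos v);
  curve_vertex : forall (f : {set G}) (w : G),
    f \in edges G -> curve f (pos w) -> w \in f }.

Section Drawing.
Variables (R : realType) (G : sgraph).
Implicit Types (D : drawing R G) (f g h : {set G}) (p q : R * R).

Definition edges_cross_at D f g p : Prop :=
  ~ range (pos D) p /\ crosses_at (curve D f) (curve D g) p.

Record good D : Prop := Good {
  good_no_triple_point : forall f g h p,
    f \in edges G -> g \in edges G -> h \in edges G -> ~ range (pos D) p ->
    curve D f p -> curve D g p -> curve D h p -> [\/ f = g, g = h | f = h];
  good_incident : forall f g p,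
    f \in edges G -> g \in edges G -> f != g -> (f :&: g)%SET != finset.set0 ->
    ~ edges_cross_at D f g p;
  good_cross_once : forall f g p q,
    f \in edges G -> g \in edges G -> f != g ->
    edges_cross_at D f g p -> edges_cross_at D f g q -> p = q;
  good_intersect_cross : forall f g p,
    f \in edges G -> g \in edges G -> f != g -> ~ range (pos D) p ->
    curve D f p -> curve D g p -> edges_cross_at D f g p }.

Definition rectilinear D : Prop :=
  forall u v : G, adj u v -> curve D [set u; v]%SET = segment (pos D u) (pos D v).

Definition crossings D : set (R * R) :=
  [set p | ~ range (pos D) p /\
     exists f g, [/\ f \in edges G, g \in edges G, f != g,
                     curve D f p & curve D g p]].

End Drawing.

(* The minimum of a set of natural numbers, as an extended real: the empty    *)
(* set gets [+oo], so no junk value arises for a graph without any drawing of *)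
(* the required kind; see [nat_minP] for nonempty sets.                       *)
Definition nat_min (R : realType) (S : set nat) : \bar R :=
  ereal_inf [set k%:R%:E | k in S].

Lemma nat_minP (R : realType) (S : set nat) : S !=set0 ->
  exists m, [/\ S m, (forall k, S k -> (m <= k)%N) & nat_min R S = m%:R%:E].
Proof.
case=> k0 Sk0.
have ex : exists k, `[< S k >] by exists k0; apply/asboolP.
case: (ex_minnP ex) => m /asboolP Sm mmin; exists m.
have mle k : S k -> (m <= k)%N by move=> Sk; apply: mmin; apply/asboolP.
split=> //; apply/eqP; rewrite eq_le; apply/andP; split.
  by apply: ereal_inf_lbound; exists m.
by apply: le_ereal_inf_tmp => _ [k Sk <-]; rewrite lee_fin ler_nat mle.
Qed.

Definition crossing_number (R : realType) (G : sgraph) : \bar R :=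
  nat_min R [set k | exists D : drawing R G,
    good D /\ (crossings D #= `I_k)%card].

Definition rectilinear_crossing_number (R : realType) (G : sgraph) : \bar R :=
  nat_min R [set k | exists D : drawing R G,
    [/\ good D, rectilinear D & (crossings D #= `I_k)%card]].

Definition A_term (ni nj nk : nat) : nat :=
  ((nj %/ 2) * ((nj - 1) %/ 2) * (nk %/ 2) * ((nk - 1) %/ 2)
   + (ni %/ 2) * ((ni - 1) %/ 2) * ((nj * nk) %/ 2))%N.

Definition A (n1 n2 n3 : nat) : nat :=
  (A_term n1 n2 n3 + A_term n2 n1 n3 + A_term n3 n1 n2)%N.

(* Main.v *)
Require Import Defs.
From mathcomp Require Import all_boot all_order all_algebra.
From mathcomp Require Import all_classical all_reals all_analysis.
From mathcomp Require Import zify ring lra.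

(* Put the three parts on three lines through the origin whose six rays
   alternate between "far" and "near": each part has the larger half of its
   vertices on its far ray, at distance between 1 and 2, and the smaller half on
   its near ray, at distance less than 1/2.  Two disjoint edges can then cross
   only if vertices of the same part lie on the same ray, and if, when all three
   parts occur, the two remaining vertices lie on rays of opposite kinds.  Four
   vertices determine at most one crossing, so counting such quadruples gives
   the bound.  The distances are chosen one vertex at a time, avoiding finitely
   many values, so that no three edges are concurrent. *)

Set Implicit Arguments.
Unset Strict Implicit.
Unset Printing Implicit Defensive.

Import Order.TTheory GRing.Theory Num.Theory.
Import numFieldNormedType.Exports.

(** * Counting quadruples *)

Section Counting.
Local Open Scope nat_scope.

Lemma leq_card_imset2 (aT1 aT2 rT : finType) (f : aT1 -> aT2 -> rT)
    (A1 : {set aT1}) (A2 : {set aT2}) :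
  #|[set f x y | x in A1, y in A2]%SET| <= #|A1| * #|A2|.
Proof. by rewrite curry_imset2X (leq_trans (leq_imset_card _ _)) // finset.cardsX. Qed.

Lemma leq_card_setU (T : finType) (A B : {set T}) : #|A :|: B| <= #|A| + #|B|.
Proof. by rewrite -cardsUI leq_addr. Qed.

Lemma card_even_ord n : #|[set i : 'I_n | ~~ odd i]%SET| = uphalf n.
Proof.
rewrite -sum1dep_card big_mkcond /=; elim: n => [|n IH]; first by rewrite big_ord0.
by rewrite big_ord_recr /= IH; case: ifP; lia.
Qed.

Lemma card_odd_ord n : #|[set i : 'I_n | odd i]%SET| = n./2.
Proof.
rewrite -sum1dep_card big_mkcond /=; elim: n => [|n IH]; first by rewrite big_ord0.
by rewrite big_ord_recr /= IH; case: ifP; lia.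
Qed.

(** The left side counts the pairs of vertices of one part that share a ray; the right side is the
    matching factor of [A_term]. Everything reduces to [2 * 'C(m, 2) + m = m * m] and the parity of
    [n]. *)
Lemma bin2_halves n : 'C(uphalf n, 2) + 'C(n./2, 2) = (n %/ 2) * ((n - 1) %/ 2).
Proof.
have bin2_dbl m : 2 * 'C(m, 2) + m = m * m.
  by elim: m => // m IH; rewrite binS bin1; nia.
have := bin2_dbl (uphalf n); have := bin2_dbl n./2.
have [-> [[-> ->]|[-> ->]]] : n./2 = n %/ 2 /\
    (uphalf n = n %/ 2 /\ (n - 1) %/ 2 = (n %/ 2).-1 \/
     uphalf n = (n %/ 2).+1 /\ (n - 1) %/ 2 = n %/ 2) by lia.
all: by nia.
Qed.

(** With [m = a + b] and [n = c + d] split into larger halves [a], [c] and smaller halves [b], [d],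
    the product [m * n] exceeds [2 * (a * d + b * c)] by [(a - b) * (c - d)], which is nonnegative
    because both larger halves lie on rays of the same kind. *)
Lemma opposite_pairs_bound m n :
  uphalf m * n./2 + m./2 * uphalf n <= (m * n) %/ 2.
Proof.
have halves k : exists a b : nat,
    [/\ k = a + b, k./2 = b, uphalf k = a, b <= a & a <= b.+1].
  by exists (uphalf k), k./2; split; lia.
have [a [b [-> -> -> ba ab]]] := halves m; have [c [d [-> -> -> dc cd]]] := halves n.
by rewrite leq_divRL //; nia.
Qed.

(** * Families of quadruples of labelled points *)

Section Labels.
Variables (T : finType) (line : T -> 'I_3) (far : T -> bool).
Implicit Types (i j k : 'I_3) (b : bool).

Definition ray i b : {set T} := [set v | (line v == i) && (far v == b)]%SET.

Definition ray_pairs i : {set {set T}} :=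
  ([set P : {set T} | P \subset ray i true & #|P| == 2]
   :|: [set P : {set T} | P \subset ray i false & #|P| == 2])%SET.

Definition opposite_pairs j k : {set {set T}} :=
  ([set [set y; z] | y in ray j true, z in ray k false]
   :|: [set [set y; z] | y in ray j false, z in ray k true])%SET.

Definition two_line_quadruples j k : {set {set T}} :=
  [set P :|: Q | P in ray_pairs j, Q in ray_pairs k]%SET.

Definition three_line_quadruples i j k : {set {set T}} :=
  [set P :|: Q | P in ray_pairs i, Q in opposite_pairs j k]%SET.

(** The two families match the two summands of [A_term (n i) (n j) (n k)]: in the first, [j] and [k]
    carry two vertices each; in the second, [i] carries two. *)
Definition line_quadruples i j k : {set {set T}} :=
  two_line_quadruples j k :|: three_line_quadruples i j k.

Definition quadruples : {set {set T}} :=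
  let o0 := inord 0 in let o1 := inord 1 in let o2 := inord 2 in
  line_quadruples o0 o1 o2 :|: line_quadruples o1 o0 o2
  :|: line_quadruples o2 o0 o1.

Lemma ray_pairs_set2 i x y : x != y -> line x = i -> line y = i ->
  far x = far y -> [set x; y]%SET \in ray_pairs i.
Proof.
move=> xy lx ly fxy; rewrite !inE cards2 xy !eqxx !andbT
  !finset.subUset !finset.sub1set !inE.
by rewrite lx ly fxy !eqxx /=; case: (far y).
Qed.

Lemma opposite_pairs_set2 j k y z : line y = j -> line z = k ->
  far y != far z -> [set y; z]%SET \in opposite_pairs j k.
Proof.
move=> ly lz fyz; rewrite inE; apply/orP.
case fy : (far y) fyz => fyz; [left | right]; apply: imset2_f;
  by rewrite !inE ?ly ?lz ?fy ?eqxx //=; case: (far z) fyz.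
Qed.

Lemma opposite_pairsC j k : opposite_pairs j k = opposite_pairs k j.
Proof.
rewrite /opposite_pairs finset.setUC; congr (_ :|: _);
  apply/setP => S; apply/imset2P/imset2P => -[y z yj zk ->];
  by exists z y; rewrite // finset.setUC.
Qed.

Lemma two_line_quadruplesC j k : two_line_quadruples j k = two_line_quadruples k j.
Proof.
by apply/setP => S; apply/imset2P/imset2P => -[y z yj zk ->];
  exists z y; rewrite // finset.setUC.
Qed.

Lemma ord3P i : [\/ i = inord 0, i = inord 1 | i = inord 2].
Proof.
case: i => [[|[|[|//]]] ?]; [constructor 1 | constructor 2 | constructor 3];
  by apply/val_inj; rewrite /= inordK.
Qed.

Lemma two_line_quadruples_sub j k : j != k ->
  two_line_quadruples j k \subset quadruples.
Proof.
move=> jk; apply/fintype.subsetP => S; rewrite /quadruples /line_quadruples !inE.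
by have [ej|ej|ej] := ord3P j; have [ek|ek|ek] := ord3P k;
  move: jk; rewrite ej ek ?eqxx // => _;
  first [move=> ->; by rewrite ?orbT
    | rewrite two_line_quadruplesC => ->; by rewrite ?orbT].
Qed.

Lemma three_line_quadruples_sub i j k : i != j -> i != k -> j != k ->
  three_line_quadruples i j k \subset quadruples.
Proof.
move=> ij ik jk; apply/fintype.subsetP => S; rewrite /quadruples /line_quadruples !inE.
have C l j' k' : three_line_quadruples l j' k' = three_line_quadruples l k' j'.
  by rewrite /three_line_quadruples opposite_pairsC.
by have [ei|ei|ei] := ord3P i; have [ej|ej|ej] := ord3P j;
  have [ek|ek|ek] := ord3P k;
  move: ij ik jk; rewrite ei ej ek ?eqxx // => _ _ _;
  first [move=> ->; by rewrite ?orbT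
    | rewrite C => ->; by rewrite ?orbT].
Qed.

Section Cardinals.
Variable n : 'I_3 -> nat.
Hypothesis card_ray_far : forall i, #|ray i true| <= uphalf (n i).
Hypothesis card_ray_near : forall i, #|ray i false| <= (n i)./2.

Lemma card_ray_pairs i : #|ray_pairs i| <= (n i %/ 2) * ((n i - 1) %/ 2).
Proof.
rewrite -bin2_halves (leq_trans (leq_card_setU _ _)) // !cards_draws.
by apply: leq_add; exact: leq_bin2l.
Qed.

Lemma card_opposite_pairs j k : #|opposite_pairs j k| <= (n j * n k) %/ 2.
Proof.
apply: leq_trans (opposite_pairs_bound _ _).
apply: (leq_trans (leq_card_setU _ _)).
by apply: leq_add; rewrite (leq_trans (leq_card_imset2 _ _ _)) // leq_mul.
Qed.

Lemma card_line_quadruples i j k :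
  #|line_quadruples i j k| <= A_term (n i) (n j) (n k).
Proof.
apply: (leq_trans (leq_card_setU _ _)); apply: leq_add.
  rewrite (leq_trans (leq_card_imset2 _ _ _)) // -mulnA leq_mul //;
  exact: card_ray_pairs.
rewrite (leq_trans (leq_card_imset2 _ _ _)) // leq_mul //.
  exact: card_ray_pairs.
exact: card_opposite_pairs.
Qed.

Lemma card_quadruples :
  #|quadruples| <= A (n (inord 0)) (n (inord 1)) (n (inord 2)).
Proof.
rewrite /A; apply: (leq_trans (leq_card_setU _ _)); apply: leq_add; last first.
  exact: card_line_quadruples.
apply: (leq_trans (leq_card_setU _ _)).
by apply: leq_add; exact: card_line_quadruples.
Qed.

End Cardinals.
End Labels.
End Counting.

(** * Sizes of the rays in the complete tripartite graph *)

Section TripartiteRays.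
Variables n1 n2 n3 : nat.
Local Notation T := (tripartite_vertex n1 n2 n3).

(** Indices start at 0, so sending the even ones to the far ray gives it the larger half [uphalf] of
    an odd part. *)
Definition tripartite_far (v : T) : bool :=
  match v with
  | inl (inl i) => ~~ odd i
  | inl (inr i) => ~~ odd i
  | inr i => ~~ odd i
  end.

Definition part_size (i : 'I_3) : nat := nth 0 [:: n1; n2; n3] i.

Lemma tripartite_ray_sub i b : exists f : 'I_(part_size i) -> T,
  ray (@part n1 n2 n3) tripartite_far i b \subset
    f @: [set x : 'I_(part_size i) | odd x != b]%SET.
Proof.
have [->|->|->] := ord3P i; rewrite /part_size inordK //=.
- exists (inl \o inl); apply/fintype.subsetP => -[[x|x]|x]; rewrite !inE /= =>
    /andP[/eqP/(congr1 val)]; rewrite /= ?inordK // => _ /eqP fx.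
  apply/imsetP; exists x => //.
  by rewrite inE -fx; case: (odd x).
- exists (inl \o inr); apply/fintype.subsetP => -[[x|x]|x]; rewrite !inE /= =>
    /andP[/eqP/(congr1 val)]; rewrite /= ?inordK // => _ /eqP fx.
  apply/imsetP; exists x => //.
  by rewrite inE -fx; case: (odd x).
- exists inr; apply/fintype.subsetP => -[[x|x]|x]; rewrite !inE /= =>
    /andP[/eqP/(congr1 val)]; rewrite /= ?inordK // => _ /eqP fx.
  apply/imsetP; exists x => //.
  by rewrite inE -fx; case: (odd x).
Qed.

Lemma card_tripartite_ray_far i :
  (#|ray (@part n1 n2 n3) tripartite_far i true| <= uphalf (part_size i))%N.
Proof.
have [f /subset_leq_card sub] := tripartite_ray_sub i true.
rewrite (leq_trans sub) // (leq_trans (leq_imset_card _ _)) // -card_even_ord.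
by apply/subset_leq_card/fintype.subsetP => x; rewrite !inE; case: (odd x).
Qed.

Lemma card_tripartite_ray_near i :
  (#|ray (@part n1 n2 n3) tripartite_far i false| <= (part_size i)./2)%N.
Proof.
have [f /subset_leq_card sub] := tripartite_ray_sub i false.
rewrite (leq_trans sub) // (leq_trans (leq_imset_card _ _)) // -card_odd_ord.
by apply/subset_leq_card/fintype.subsetP => x; rewrite !inE; case: (odd x).
Qed.

Lemma card_tripartite_quadruples :
  (#|quadruples (@part n1 n2 n3) tripartite_far| <= A n1 n2 n3)%N.
Proof.
have := card_quadruples card_tripartite_ray_far card_tripartite_ray_near.
by rewrite /part_size !inordK.
Qed.

End TripartiteRays.

Local Open Scope classical_set_scope.
Local Open Scope ring_scope.

(** * Segments in the plane *)

Section Segments.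
Variable R : realType.
Local Notation plane := (R * R)%type.
Implicit Types (a b c d p q : plane).

Lemma plane_eqP p q : p = q <-> p.1 = q.1 /\ p.2 = q.2.
Proof. by case: p q => [? ?] [? ?] /=; split=> [[-> ->]|[-> ->]]. Qed.

Lemma segmentP p q r : segment p q r <->
  exists t, [/\ 0 <= t, t <= 1, r.1 = (1 - t) * p.1 + t * q.1
    & r.2 = (1 - t) * p.2 + t * q.2].
Proof.
split=> [[t /=]|[t [t0 t1 r1 r2]]].
  by rewrite in_itv /= => /andP[t0 t1] <-; exists t.
by exists t; [rewrite /= in_itv /= t0 | apply/plane_eqP].
Qed.

Lemma segmentC p q : segment p q = segment q p.
Proof.
suff sub a b : segment a b `<=` segment b a by rewrite eqEsubset; split; exact: sub.
move=> r /segmentP[t [t0 t1 r1 r2]]; apply/segmentP; exists (1 - t).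
by split; [lra | lra | rewrite r1; ring | rewrite r2; ring].
Qed.

Definition cross2 p q : R := p.1 * q.2 - p.2 * q.1.

(** The vector [p - a] is both [s * (b - a)] and [u * (c - a)] with [s] and [u] positive, so the end
    with the larger parameter is the one nearer to [a], and it lies on the other segment. *)
Lemma segments_same_origin a b c p : segment a b p -> segment a c p ->
  p <> a -> segment a c b \/ segment a b c.
Proof.
move=> /segmentP[s [s0 s1 ps1 ps2]] /segmentP[u [u0 u1 pu1 pu2]] pa.
have s_neq0 : s != 0.
  by apply/eqP => s_eq0; apply: pa; apply/plane_eqP; rewrite ps1 ps2 s_eq0; split; ring.
have u_neq0 : u != 0.
  by apply/eqP => u_eq0; apply: pa; apply/plane_eqP; rewrite pu1 pu2 u_eq0; split; ring.
have s_gt0 : 0 < s by rewrite lt_def s_neq0.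
have u_gt0 : 0 < u by rewrite lt_def u_neq0.
have [us|su] := leP u s; [left | right]; apply/segmentP.
  exists (u / s); split; first exact: divr_ge0.
  - by rewrite ler_pdivrMr ?mul1r.
  - by apply: (mulfI s_neq0); transitivity (p.1 - (1 - s) * a.1);
      [rewrite ps1; ring | rewrite pu1; field].
  - by apply: (mulfI s_neq0); transitivity (p.2 - (1 - s) * a.2);
      [rewrite ps2; ring | rewrite pu2; field].
exists (s / u); split; first exact: divr_ge0.
- by rewrite ler_pdivrMr ?mul1r // ltW.
- by apply: (mulfI u_neq0); transitivity (p.1 - (1 - u) * a.1);
    [rewrite pu1; ring | rewrite ps1; field].
- by apply: (mulfI u_neq0); transitivity (p.2 - (1 - u) * a.2);
    [rewrite pu2; ring | rewrite ps2; field].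
Qed.

Lemma cross2_eq0 p q : p <> (0, 0) -> cross2 p q = 0 ->
  exists m, q.1 = m * p.1 /\ q.2 = m * p.2.
Proof.
case: p => x y /= p0; rewrite /cross2 /= => e.
have [x0|x_neq0] := eqVneq x 0; last first.
  exists (q.1 / x); split; first by field.
  apply: (mulfI x_neq0); transitivity (y * q.1); [lra | by field].
have y_neq0 : y != 0 by apply/eqP => y0; apply: p0; rewrite x0 y0.
exists (q.2 / y); split; last by field.
by apply: (mulfI y_neq0); transitivity (x * q.2); [lra | field].
Qed.

(** The common point puts both segments on one line; if neither [c] nor [d] lies on [ab], then [cd]
    covers [ab] and contains [a]. *)
Lemma segments_parallel a b c d p : a <> b -> c <> d ->
  segment a b p -> segment c d p -> cross2 (b - a) (d - c) = 0 ->
  [\/ segment a b c, segment a b d | segment c d a].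
Proof.
move=> ab cd /segmentP[s [s0 s1 ps1 ps2]] /segmentP[u [u0 u1 pu1 pu2]].
have ba0 : b - a <> (0, 0) by move=> e; apply: ab; apply/esym/subr0_eq.
move=> /(cross2_eq0 ba0)[m /= [e1 e2]].
have m_neq0 : m != 0.
  apply/eqP => m0; apply: cd; apply/plane_eqP; move: e1 e2; rewrite m0.
  by split; lra.
(* On the line with [a] at 0 and [b] at 1, [c] has coordinate [s - u * m] and [d] has coordinate
   [s - u * m + m]. *)
have c1 : c.1 = (1 - (s - u * m)) * a.1 + (s - u * m) * b.1.
  transitivity (p.1 - u * (d.1 - c.1)); [rewrite pu1; ring|].
  by rewrite e1 ps1; ring.
have c2 : c.2 = (1 - (s - u * m)) * a.2 + (s - u * m) * b.2.
  transitivity (p.2 - u * (d.2 - c.2)); [rewrite pu2; ring|].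
  by rewrite e2 ps2; ring.
have d1 : d.1 = (1 - (s - u * m + m)) * a.1 + (s - u * m + m) * b.1.
  transitivity (c.1 + (d.1 - c.1)); [ring|].
  by rewrite e1 c1; ring.
have d2 : d.2 = (1 - (s - u * m + m)) * a.2 + (s - u * m + m) * b.2.
  transitivity (c.2 + (d.2 - c.2)); [ring|].
  by rewrite e2 c2; ring.
have a1 : a.1 = (1 - - (s - u * m) / m) * c.1 + - (s - u * m) / m * d.1.
  by rewrite c1 d1; field.
have a2 : a.2 = (1 - - (s - u * m) / m) * c.2 + - (s - u * m) / m * d.2.
  by rewrite c2 d2; field.
have [c_in|c_out] := boolP ((0 <= s - u * m) && (s - u * m <= 1)).
  case/andP: c_in => ? ?.
  by constructor 1; apply/segmentP; exists (s - u * m); split.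
have [d_in|d_out] := boolP ((0 <= s - u * m + m) && (s - u * m + m <= 1)).
  case/andP: d_in => ? ?.
  by constructor 2; apply/segmentP; exists (s - u * m + m); split.
(* Both coordinates miss the unit interval, but [p] lies between [c] and [d] and has coordinate [s]
   inside it. So [c] and [d] are on different sides of the interval, in the order given by the sign
   of [m]. *)
constructor 3; apply/segmentP; exists (- (s - u * m) / m); split => //.
- have [m_gt0|m_lt0] : 0 < m \/ m < 0 by apply/orP; rewrite -neq_lt eq_sym.
  + apply: divr_ge0; last exact: ltW.
    by move: c_out d_out; rewrite !negb_and -!ltNge => /orP[] ? /orP[] ?; nra.
  + rewrite -mulrNN -invrN; apply: divr_ge0; last lra.
    by move: c_out d_out; rewrite !negb_and -!ltNge => /orP[] ? /orP[] ?; nra.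
- have [m_gt0|m_lt0] : 0 < m \/ m < 0 by apply/orP; rewrite -neq_lt eq_sym.
  + rewrite ler_pdivrMr // mul1r.
    by move: c_out d_out; rewrite !negb_and -!ltNge => /orP[] ? /orP[] ?; nra.
  + rewrite ler_ndivrMr // mul1r.
    by move: c_out d_out; rewrite !negb_and -!ltNge => /orP[] ? /orP[] ?; nra.
Qed.

Lemma segments_meet_once a b c d p q : cross2 (b - a) (d - c) != 0 ->
  segment a b p -> segment c d p -> segment a b q -> segment c d q -> p = q.
Proof.
move=> D /segmentP[s [_ _ ps1 ps2]] /segmentP[u [_ _ pu1 pu2]].
move=> /segmentP[s' [_ _ qs1 qs2]] /segmentP[u' [_ _ qu1 qu2]].
have e1 : (s - s') * (b.1 - a.1) = (u - u') * (d.1 - c.1).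
  transitivity (p.1 - q.1); [rewrite ps1 qs1 | rewrite pu1 qu1]; ring.
have e2 : (s - s') * (b.2 - a.2) = (u - u') * (d.2 - c.2).
  transitivity (p.2 - q.2); [rewrite ps2 qs2 | rewrite pu2 qu2]; ring.
have : (s - s') * cross2 (b - a) (d - c) = 0.
  transitivity ((s - s') * (b.1 - a.1) * (d.2 - c.2) -
                (s - s') * (b.2 - a.2) * (d.1 - c.1)).
    by rewrite /cross2 /=; ring.
  by rewrite e1 e2; ring.
move/eqP; rewrite mulf_eq0 (negbTE D) orbF subr_eq0 => /eqP ss'.
by apply/plane_eqP; rewrite ps1 ps2 qs1 qs2 ss'.
Qed.

(* The two intersections give two affine dependencies of the four points with
   different sign patterns; eliminating [d] from them leaves a dependency of
   [a], [b], [c], that is, an overlap of the segments [ab] and [ac]. *)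
Lemma segments_two_matchings a b c d p q : a <> b -> a <> c ->
  segment a b p -> segment c d p -> segment a c q -> segment b d q ->
  [\/ p = a, p = c | exists r, [/\ r <> a, segment a b r & segment a c r]].
Proof.
move=> ab ac /segmentP[s [s0 s1 ps1 ps2]] /segmentP[u [u0 u1 pu1 pu2]].
move=> /segmentP[s' [s'0 s'1 qs1 qs2]] /segmentP[u' [u'0 u'1 qu1 qu2]].
(* Expand [p - a] and [q - a] along both of their segments. Taking [u'] times the first relation
   minus [u] times the second eliminates [d - a] and leaves [x * (b - a) = y * (c - a)] with
   nonnegative coefficients. *)
pose x := s * u' + u * (1 - u'); pose y := u' * (1 - u) + u * s'.
have e1 : x * (b.1 - a.1) = y * (c.1 - a.1).
  rewrite ps1 in pu1; rewrite qs1 in qu1.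
  transitivity (u' * (((1 - s) * a.1 + s * b.1) - a.1)
    - u * (((1 - s') * a.1 + s' * c.1) - a.1)
    + u * s' * (c.1 - a.1) + u * (1 - u') * (b.1 - a.1)); first by rewrite /x; ring.
  by rewrite pu1 qu1 /y; ring.
have e2 : x * (b.2 - a.2) = y * (c.2 - a.2).
  rewrite ps2 in pu2; rewrite qs2 in qu2.
  transitivity (u' * (((1 - s) * a.2 + s * b.2) - a.2)
    - u * (((1 - s') * a.2 + s' * c.2) - a.2)
    + u * s' * (c.2 - a.2) + u * (1 - u') * (b.2 - a.2)); first by rewrite /x; ring.
  by rewrite pu2 qu2 /y; ring.
have x0 : 0 <= x by rewrite /x; nra.
have y0 : 0 <= y by rewrite /y; nra.
have [x_eq0|x_neq0] := eqVneq x 0.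
  have y_eq0 : y = 0.
    apply/eqP; apply/negP => /negP y_neq0; apply: ac; apply/plane_eqP.
    by split; apply/eqP; rewrite eq_sym -subr_eq0
      -(mulrI_eq0 _ (mulfI y_neq0)) -?e1 -?e2 x_eq0 mul0r.
  have [u'_eq0|u'_neq0] := eqVneq u' 0.
    constructor 2; apply/plane_eqP; rewrite pu1 pu2.
    have -> : u = 0 by move: x_eq0; rewrite /x u'_eq0; lra.
    by split; ring.
  constructor 1; apply/plane_eqP; rewrite ps1 ps2.
  suff -> : s = 0 by split; ring.
  apply: (mulIf u'_neq0); rewrite mul0r.
  have : 0 <= s * u' by exact: mulr_ge0.
  have : 0 <= u * (1 - u') by apply: mulr_ge0; lra.
  by move: x_eq0; rewrite /x; lra.
have [y_eq0|y_neq0] := eqVneq y 0.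
  exfalso; apply: ab; apply/plane_eqP.
  by split; apply/eqP; rewrite eq_sym -subr_eq0
    -(mulrI_eq0 _ (mulfI x_neq0)) ?e1 ?e2 y_eq0 mul0r.
have x_gt0 : 0 < x by rewrite lt_def x_neq0.
have y_gt0 : 0 < y by rewrite lt_def y_neq0.
have xy_neq0 : x + y != 0 by rewrite gt_eqF // addr_gt0.
(* Since [x * (b - a) = y * (c - a)], this point has parameter [x / (x + y)] on [ab] and
   [y / (x + y)] on [ac]. *)
constructor 3; pose r := (a + (x / (x + y)) *: (b - a)).
exists r; split.
- move=> /plane_eqP[/= r1 r2]; apply: ab; apply/plane_eqP.
  have z : x / (x + y) != 0 by rewrite mulf_neq0 // invr_eq0.
  split; apply/eqP; rewrite eq_sym -subr_eq0 -(mulrI_eq0 _ (mulfI z)).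
    by apply/eqP/(@addrI _ a.1); rewrite addr0.
  by apply/eqP/(@addrI _ a.2); rewrite addr0.
- apply/segmentP; exists (x / (x + y)); split.
  + by apply: divr_ge0; lra.
  + by rewrite ler_pdivrMr; [lra | exact: addr_gt0].
  + by rewrite /r /= /GRing.scale /=; ring.
  + by rewrite /r /= /GRing.scale /=; ring.
- apply/segmentP; exists (y / (x + y)); split.
  + by apply: divr_ge0; lra.
  + by rewrite ler_pdivrMr; [lra | exact: addr_gt0].
  + transitivity (a.1 + (x * (b.1 - a.1)) / (x + y)); last by rewrite e1; field.
    by rewrite /r /= /GRing.scale /=; field.
  + transitivity (a.2 + (x * (b.2 - a.2)) / (x + y)); last by rewrite e2; field.
    by rewrite /r /= /GRing.scale /=; field.
Qed.

End Segments.

(** * Segments as arcs, and transversal segments as crossing curves *)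

Section SegmentTopology.
Variable R : realType.
Local Notation plane := (R * R)%type.
Implicit Types (a b c d p q : plane).

Lemma segment_simple_arc p q : p <> q -> simple_arc (segment p q) p q.
Proof.
move=> pq; exists (fun t => (1 - t) *: p + t *: q); split=> //.
- apply: continuous_subspaceT => t.
  apply: cvgD.
    by apply: cvgZr_tmp; apply: cvgB; [exact: cvg_cst | exact: cvg_id].
  by apply: cvgZr_tmp; exact: cvg_id.
- move=> s t _ _ /plane_eqP[/= e1 e2]; apply/eqP/negP => /negP st.
  have st0 : t - s != 0 by rewrite subr_eq0 eq_sym.
  apply: pq; apply/plane_eqP; move: e1 e2; rewrite /GRing.scale /= => e1 e2.
  by split; apply: (mulfI st0); apply/eqP; rewrite -subr_eq0; apply/eqP; lra.
- by rewrite subr0 scale1r scale0r addr0.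
- by rewrite subrr scale1r scale0r add0r.
Qed.

Lemma continuous_affine (x y z : R) :
  continuous (fun q : plane => x * q.1 + y * q.2 + z).
Proof.
move=> q; apply: cvgD; last exact: cvg_cst.
by apply: cvgD; apply: cvgM;
  [exact: cvg_cst | exact: cvg_fst | exact: cvg_cst | exact: cvg_snd].
Qed.

Lemma continuous_pair (f g : plane -> R) : continuous f -> continuous g ->
  continuous (fun q => (f q, g q)).
Proof. by move=> cf cg q; have := cvg_pair (cf q) (cg q); exact. Qed.

Lemma segments_crosses_at a b c d p : cross2 (b - a) (d - c) != 0 ->
  segment a b p -> segment c d p -> p <> a -> p <> b -> p <> c -> p <> d ->
  crosses_at (segment a b) (segment c d) p.
Proof.
move=> D /segmentP[s [s0 s1 ps1 ps2]] /segmentP[u [u0 u1 pu1 pu2]] pa pb pc pd.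
have {}s0 : 0 < s.
  rewrite lt_def s0 andbT; apply/eqP => e; apply: pa; apply/plane_eqP.
  by rewrite ps1 ps2 e; split; ring.
have {}s1 : s < 1.
  rewrite lt_def s1 andbT; apply/eqP => e; apply: pb; apply/plane_eqP.
  by rewrite ps1 ps2 -e; split; ring.
have {}u0 : 0 < u.
  rewrite lt_def u0 andbT; apply/eqP => e; apply: pc; apply/plane_eqP.
  by rewrite pu1 pu2 e; split; ring.
have {}u1 : u < 1.
  rewrite lt_def u1 andbT; apply/eqP => e; apply: pd; apply/plane_eqP.
  by rewrite pu1 pu2 -e; split; ring.
(* The margin [e] keeps [s] and [u] between 0 and 1 under any shift smaller than [e]; on the
   neighbourhood [U] below, the segments therefore agree with their full lines. *)
have [e [e0 es es' eu eu']] : exists e : R,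
    [/\ 0 < e, e <= s, e <= 1 - s, e <= u & e <= 1 - u].
  exists (Num.min (Num.min s (1 - s)) (Num.min u (1 - u))).
  by rewrite !lt_min !ge_min !lexx ?orbT; split=> //;
    apply/andP; split; apply/andP; split; lra.
have [v ve] : exists v, v = b - a by exists (b - a).
have [w we] : exists w, w = d - c by exists (d - c).
have [K Ku] : exists K, K = v.1 * w.2 - v.2 * w.1 by eexists.
have Kn : K != 0 by rewrite Ku ve we.
(* The coordinates of [q - p] in the basis [v, w] *)
pose h (q : plane) : plane :=
  ((w.2 / K) * q.1 + (- w.1 / K) * q.2 + (p.2 * w.1 - p.1 * w.2) / K,
   (- v.2 / K) * q.1 + (v.1 / K) * q.2 + (p.1 * v.2 - p.2 * v.1) / K).
pose g (z : plane) : plane :=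
  (v.1 * z.1 + w.1 * z.2 + p.1, v.2 * z.1 + w.2 * z.2 + p.2).
have Kn' : v.1 * w.2 - v.2 * w.1 != 0 by rewrite -Ku.
have hK q : g (h q) = q.
  by apply/plane_eqP; rewrite /g /h /= Ku; split; field.
have gK z : h (g z) = z.
  by apply/plane_eqP; rewrite /g /h /= Ku; split; field.
have g1 z : (g z).1 = v.1 * z.1 + w.1 * z.2 + p.1 by [].
have g2 z : (g z).2 = v.2 * z.1 + w.2 * z.2 + p.2 by [].
have hc : continuous h by apply: continuous_pair; exact: continuous_affine.
have gc : continuous g by apply: continuous_pair; exact: continuous_affine.
pose U := h @^-1` (ball ((0, 0) : plane) e).
have UP q : U q -> `|(h q).1| < e /\ `|(h q).2| < e.
  by rewrite /U /= => -[]; rewrite /ball /= !sub0r !normrN.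
have hp : h p = (0, 0).
  by apply/plane_eqP; rewrite /h /=; split; ring.
exists U, h; split=> //.
- split; last by rewrite /U /= hp; exact: ballxx.
  by move/continuousP: hc; apply; exact: ball_open.
- split.
  + by move=> x y _ _ hxy; rewrite -(hK x) hxy hK.
  + by move=> x _; exact: hc.
  + move=> W _ oW; rewrite (_ : h @` W = g @^-1` W).
      by move/continuousP: gc; apply.
    rewrite eqEsubset; split=> [_ [x Wx <-]|z Wz]; first by rewrite /= hK.
    by exists (g z).
- move=> q /UP[]; rewrite !ltr_norml => /andP[h1l h1r] _; split.
    move=> /segmentP[t [_ _ qt1 qt2]]; rewrite /h /= qt1 qt2 ps1 ps2 ve /=.
    by field.
  move=> h2; apply/segmentP; exists (s + (h q).1).
  have [q1 q2] : q.1 = v.1 * (h q).1 + p.1 /\ q.2 = v.2 * (h q).1 + p.2.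
    by rewrite -{1}(hK q) -{3}(hK q) g1 g2 h2; split; ring.
  split; [lra|lra| |].
    by rewrite q1 ps1 ve /=; ring.
  by rewrite q2 ps2 ve /=; ring.
- move=> q /UP[] _; rewrite !ltr_norml => /andP[h2l h2r]; split.
    move=> /segmentP[t [_ _ qt1 qt2]]; rewrite /h /= qt1 qt2 pu1 pu2 we /=.
    by field.
  move=> h1; apply/segmentP; exists (u + (h q).2).
  have [q1 q2] : q.1 = w.1 * (h q).2 + p.1 /\ q.2 = w.2 * (h q).2 + p.2.
    by rewrite -{1}(hK q) -{3}(hK q) g1 g2 h1; split; ring.
  split; [lra|lra| |].
    by rewrite q1 pu1 we /=; ring.
  by rewrite q2 pu2 we /=; ring.
Qed.

End SegmentTopology.

(** * Vertices on alternating rays *)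

(* The three directions sum to 0, so the rays at [dir i] and [- dir i]
   alternate around the origin. *)
Definition dir (R : realType) (i : 'I_3) : R * R :=
  match val i with 0%N => (1, 0) | 1%N => (0, 1) | _ => (- 1, - 1) end.

(** The number is a signed coordinate along [dir], so near rays are negative half-lines. The gap
    between 1/2 and 1 is what [vertex_on_edge] and [opposite_rays_false] rest on. *)
Definition in_ray (R : realType) (b : bool) (x : R) : bool :=
  if b then 1 < x < 2 else - 2^-1 < x < 0.

Section Directions.
Variable R : realType.
Implicit Types (i j k : 'I_3) (x y z : R).

Lemma dir_sum i j k : i != j -> i != k -> j != k ->
  (dir R k).1 = - (dir R i).1 - (dir R j).1 /\
  (dir R k).2 = - (dir R i).2 - (dir R j).2.
Proof.
case: i j k => [[|[|[|?]]] ?] [[|[|[|?]]] ?] [[|[|[|?]]] ?] //= _ _ _;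
  by rewrite /dir /=; split; ring.
Qed.

Lemma dir_free i j x y x' y' : i != j ->
  x * (dir R i).1 + y * (dir R j).1 = x' * (dir R i).1 + y' * (dir R j).1 ->
  x * (dir R i).2 + y * (dir R j).2 = x' * (dir R i).2 + y' * (dir R j).2 ->
  x = x' /\ y = y'.
Proof.
by case: i j => [[|[|[|?]]] ?] [[|[|[|?]]] ?] //= _; rewrite /dir /=; split; lra.
Qed.

Lemma in_ray_neq0 b x : in_ray b x -> x != 0.
Proof. by rewrite /in_ray; case: b => /andP[? ?]; apply/eqP; lra. Qed.

Lemma in_rayP b x : in_ray b x ->
  [/\ b = true, 1 < x & x < 2] \/ [/\ b = false, - 2^-1 < x & x < 0].
Proof. by case: b => /= /andP[? ?]; [left | right]. Qed.

(** These are the equations of a crossing between [ab] and [cd], where [a] and [c] lie on opposite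
    rays of one line, [b] is far and [d] is near, on the other two lines. If [x] is far, adding the
    equations gives at least 1 on the left but less than 1 on the right, as [- w] is below 1/2. If
    [x] is near, the signs force [s = 0] and then [x >= 0]. *)
Lemma opposite_rays_false (x y z w s u : R) : 0 <= s <= 1 -> 0 <= u <= 1 ->
  1 < y -> - 2^-1 < w < 0 ->
  (1 < x) && (- 2^-1 < z < 0) || (- 2^-1 < x < 0) && (1 < z) ->
  (1 - s) * x = (1 - u) * z - u * w -> s * y = - (u * w) -> False.
Proof.
move=> /andP[s0 s1] /andP[u0 u1] y1 /andP[w1 w0] /orP[]; last first.
  move=> /andP[/andP[x1 x0] z1] e1 e2.
  have : 0 <= (1 - s) * - x by apply: mulr_ge0; lra.
  have : 0 <= (1 - u) * (z - 1) by apply: mulr_ge0; lra.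
  have : 0 <= s * (y - 1) by apply: mulr_ge0; lra.
  have : 0 <= u * - w by apply: mulr_ge0; lra.
  move=> ? ? ? ?; have s_eq0 : s = 0 by lra.
  by move: e1 e2; rewrite s_eq0 => e1 e2; lra.
move=> /andP[x1 /andP[z1 z0]] e1 e2.
have : 0 <= (1 - s) * (x - 1) by apply: mulr_ge0; lra.
have : 0 <= (1 - u) * - z by apply: mulr_ge0; lra.
have : 0 <= s * (y - 1) by apply: mulr_ge0; lra.
have : 0 <= u * (w + 2^-1) by apply: mulr_ge0; lra.
have : 0 <= (1 - u) * - w by apply: mulr_ge0; lra.
by lra.
Qed.

End Directions.

Section Configurations.
Variables (R : realType) (T : finType) (line : T -> 'I_3) (far : T -> bool).
Implicit Types (t : T -> R) (a b c d e f v w : T).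
Local Notation plane := (R * R)%type.

Definition vpoint t v : plane := t v *: dir R (line v).

Definition configuration t :=
  (forall v, in_ray (far v) (t v)) /\ injective t.

Local Notation seg t a b := (segment (vpoint t a) (vpoint t b)).

Lemma segment_coord t a b p : seg t a b p -> exists s,
  [/\ 0 <= s, s <= 1,
   p.1 = (1 - s) * t a * (dir R (line a)).1 + s * t b * (dir R (line b)).1 &
   p.2 = (1 - s) * t a * (dir R (line a)).2 + s * t b * (dir R (line b)).2].
Proof.
move=> /segmentP[s [s0 s1 p1 p2]]; exists s; split=> //.
- by rewrite p1 /vpoint /= /GRing.scale /=; ring.
- by rewrite p2 /vpoint /= /GRing.scale /=; ring.
Qed.

Section FixedConfiguration.
Variable t : T -> R.
Hypothesis t_conf : configuration t.

Lemma configuration_neq v w : v != w -> t v <> t w.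
Proof. by move=> /eqP vw /(proj2 t_conf). Qed.

Lemma configuration_ray v :
  [/\ far v = true, 1 < t v & t v < 2] \/
  [/\ far v = false, - 2^-1 < t v & t v < 0].
Proof. exact/in_rayP/(proj1 t_conf). Qed.

Lemma vpoint_inj : injective (vpoint t).
Proof.
move=> v w /plane_eqP[]; rewrite /vpoint /= /GRing.scale /= => e1 e2.
apply: (proj2 t_conf).
have [lvw|lvw] := eqVneq (line v) (line w).
  have [i wi] : exists i, line w != i.
    by case: (line w) => [[|?] ?]; [exists 1 | exists 0].
  rewrite lvw in e1 e2.
  by case: (@dir_free R _ _ (t v) 0 (t w) 0 wi); rewrite ?mul0r ?addr0.
have tv0 := in_ray_neq0 (proj1 t_conf v).
case: (@dir_free R _ _ (t v) 0 0 (t w) lvw); rewrite ?mul0r ?addr0 ?add0r //.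
by move=> tv; rewrite tv eqxx in tv0.
Qed.

Lemma vertex_on_edge a b w : line a != line b -> seg t a b (vpoint t w) ->
  w = a \/ w = b.
Proof.
move=> lab /segment_coord[s [s0 s1]]; rewrite /vpoint /= /GRing.scale /=.
have [lwa|lwa] := eqVneq (line w) (line a).
  rewrite lwa => e1 e2.
  have [||tw /esym/eqP] := @dir_free R _ _ (t w) 0 ((1 - s) * t a) (s * t b) lab.
  - by rewrite -e1; ring.
  - by rewrite -e2; ring.
  rewrite mulf_eq0 (negbTE (in_ray_neq0 (proj1 t_conf b))) orbF => /eqP se.
  by left; apply: (proj2 t_conf); rewrite tw se; ring.
have [lwb|lwb] := eqVneq (line w) (line b).
  rewrite lwb => e1 e2.
  have [||/esym/eqP] := @dir_free R _ _ 0 (t w) ((1 - s) * t a) (s * t b) lab.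
  - by rewrite -e1; ring.
  - by rewrite -e2; ring.
  rewrite mulf_eq0 (negbTE (in_ray_neq0 (proj1 t_conf a))) orbF => /eqP se tw.
  right; apply: (proj2 t_conf); rewrite tw.
  have -> : s = 1 by lra.
  by ring.
rewrite eq_sym in lwa; rewrite eq_sym in lwb.
have [d1 d2] := dir_sum R lab lwa lwb.
rewrite d1 d2 => e1 e2; exfalso.
have [] := @dir_free R _ _ (- t w) (- t w) ((1 - s) * t a) (s * t b) lab.
- by rewrite -e1; ring.
- by rewrite -e2; ring.
(* Now [(1 - s) * t a = s * t b = - t w]. So [t a] and [t b] have the sign opposite to [t w], and
   the reciprocals of their absolute values add up to that of [t w]. If [w] is near, the sum is
   below 2 and the reciprocal of [t w] above 2; if [w] is far, they are above 4 and below 1. *)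
move=> wa wb.
have [[_ ? ?]|[_ ? ?]] := configuration_ray w;
have [[_ ? ?]|[_ ? ?]] := configuration_ray a;
have [[_ ? ?]|[_ ? ?]] := configuration_ray b; nra.
Qed.

Lemma edges_incident a b c p : b != c -> line a != line b -> line a != line c ->
  seg t a b p -> seg t a c p -> p = vpoint t a.
Proof.
move=> bc lab lac pab pac; apply: contrapT => pa.
have [|] := segments_same_origin pab pac pa => /vertex_on_edge [] // e.
- by rewrite e eqxx in lab.
- by rewrite e eqxx in bc.
- by rewrite e eqxx in lac.
- by rewrite e eqxx in bc.
Qed.

(** Parallel edges with a common point would overlap, which puts an end of one on the other, against
    [vertex_on_edge]. *)
Lemma edges_transversal a b c d p : uniq [:: a; b; c; d] ->
  line a != line b -> line c != line d -> seg t a b p -> seg t c d p ->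
  cross2 (vpoint t b - vpoint t a) (vpoint t d - vpoint t c) != 0.
Proof.
rewrite /= !inE !negb_or => /and4P[/and3P[ab ac ad] /andP[bc bd] cd _].
move=> lab lcd pab pcd; apply/negP => /eqP D.
have [||||] := segments_parallel _ _ pab pcd D.
- by move/vpoint_inj/eqP; exact/negP.
- by move/vpoint_inj/eqP; exact/negP.
- by move=> /(vertex_on_edge lab)[] /eqP; rewrite eq_sym; exact/negP.
- by move=> /(vertex_on_edge lab)[] /eqP; rewrite eq_sym; exact/negP.
- by move=> /(vertex_on_edge lcd)[] /eqP; exact/negP.
Qed.

Lemma edges_meet_once a b c d p q : uniq [:: a; b; c; d] ->
  line a != line b -> line c != line d -> seg t a b p -> seg t c d p ->
  seg t a b q -> seg t c d q -> p = q.
Proof.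
move=> U lab lcd pab pcd; apply: segments_meet_once => //.
exact: edges_transversal U lab lcd pab pcd.
Qed.

(** This makes a quadruple of vertices account for at most one crossing: each outcome of
    [segments_two_matchings] places a vertex on a foreign edge or makes two edges overlap. *)
Lemma edges_one_matching a b c d p q : uniq [:: a; b; c; d] ->
  line a != line b -> line c != line d -> line a != line c ->
  seg t a b p -> seg t c d p -> seg t a c q -> seg t b d q -> False.
Proof.
move=> U lab lcd lac pab pcd qac qbd.
move: (U); rewrite /= !inE !negb_or => /and4P[/and3P[ab ac ad] /andP[bc bd] cd _].
have [||pa|pc|[r [ra rab rac]]] := segments_two_matchings _ _ pab pcd qac qbd.
- by move/vpoint_inj/eqP; exact/negP.
- by move/vpoint_inj/eqP; exact/negP.
- move: pcd; rewrite pa => /(vertex_on_edge lcd)[] /eqP; exact/negP.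
- by move: pab; rewrite pc => /(vertex_on_edge lab)[] /eqP; rewrite eq_sym; exact/negP.
- by apply: ra; exact: edges_incident bc lab lac rab rac.
Qed.

(** Comparing coordinates gives [(1 - s) * t a = (1 - u) * t c] and [s * t b = u * t d]. Opposite
    signs in one equation make both its sides vanish, and the other equation then identifies two
    coordinates that are distinct. *)
Lemma crossing_two_lines a b c d p : a != c -> b != d ->
  line a != line b -> line c = line a -> line d = line b ->
  seg t a b p -> seg t c d p -> far a = far c /\ far b = far d.
Proof.
move=> ac bd lab lca ldb /segment_coord[s [s0 s1 e1 e2]].
move=> /segment_coord[u [u0 u1]]; rewrite lca ldb e1 e2 => f1 f2.
have [ta tb] := dir_free lab f1 f2.
have tac := configuration_neq ac; have tbd := configuration_neq bd.
have su1 : s = 1 -> u = 1 -> False.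
  by move=> s1' u1'; apply: tbd; move: tb; rewrite s1' u1'; lra.
have su0 : s = 0 -> u = 0 -> False.
  by move=> s1' u1'; apply: tac; move: ta; rewrite s1' u1'; lra.
split.
  have [[-> ? ?]|[-> ? ?]] := configuration_ray a;
  have [[-> ? ?]|[-> ? ?]] := configuration_ray c => //; exfalso; apply: su1; nra.
have [[-> ? ?]|[-> ? ?]] := configuration_ray b;
have [[-> ? ?]|[-> ? ?]] := configuration_ray d => //; exfalso; apply: su0; nra.
Qed.

(** The third direction is minus the sum of the others, so [s * t b = - (u * t d)]. If [b] and [d]
    were of the same kind, this would force [s = u = 0] and [t a = t c]. With [b] and [d] of
    opposite kinds, [opposite_rays_false], applied with the edges exchanged when [d] is the far one,
    excludes [a] and [c] on opposite rays. *)
Lemma crossing_three_lines a b c d p : a != c ->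
  line a != line b -> line a != line d -> line b != line d -> line c = line a ->
  seg t a b p -> seg t c d p -> far a = far c /\ far b != far d.
Proof.
move=> ac lab lad lbd lca /segment_coord[s [s0 s1 e1 e2]].
move=> /segment_coord[u [u0 u1]]; rewrite lca e1 e2 => f1 f2.
have [d1 d2] := dir_sum R lab lad lbd.
have [] := @dir_free R _ _ ((1 - s) * t a) (s * t b)
  ((1 - u) * t c - u * t d) (- (u * t d)) lab.
- by rewrite f1 d1; ring.
- by rewrite f2 d2; ring.
move=> ta tb; have tac := configuration_neq ac.
have su0 : s = 0 -> u = 0 -> False.
  by move=> s1' u1'; apply: tac; move: ta; rewrite s1' u1'; lra.
have bd : far b != far d.
  have [[-> ? ?]|[-> ? ?]] := configuration_ray b;
  have [[-> ? ?]|[-> ? ?]] := configuration_ray d => //; exfalso; apply: su0; nra.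
split=> //; move: bd.
have [[-> ? ?]|[-> ? ?]] := configuration_ray b;
have [[-> ? ?]|[-> ? ?]] := configuration_ray d => // _.
- have [[-> ? ?]|[-> ? ?]] := configuration_ray a;
  have [[-> ? ?]|[-> ? ?]] := configuration_ray c => //; exfalso;
  apply: (@opposite_rays_false _ (t a) (t b) (t c) (t d) s u) => //; lra.
- have [[-> ? ?]|[-> ? ?]] := configuration_ray a;
  have [[-> ? ?]|[-> ? ?]] := configuration_ray c => //; exfalso;
  apply: (@opposite_rays_false _ (t c) (t d) (t a) (t b) u s) => //; lra.
Qed.

End FixedConfiguration.
End Configurations.

(** * General position *)

(** Each [B k] holds at one value at most, so halving the current interval once per [k] leaves a
    half that avoids it. *)
Lemma avoid_subsingletons (R : realFieldType) (K : Type) (B : K -> R -> Prop)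
    (ks : seq K) (lo hi : R) :
  (forall k x y, B k x -> B k y -> x = y) -> lo < hi ->
  exists lo' hi', [/\ lo <= lo', lo' < hi', hi' <= hi &
    forall x, lo' < x < hi' -> List.Forall (fun k => ~ B k x) ks].
Proof.
move=> B1 lohi; elim: ks => [|k ks [l [h [lol lh hhi IH]]]].
  by exists lo, hi; split.
have [[x [xl Bx]]|nB] := pselect (exists x, l < x <= (l + h) / 2 /\ B k x).
  exists ((l + h) / 2), h; split; [lra|lra|lra|] => y yh.
  constructor; last by apply: IH; lra.
  by move=> By; have := B1 _ _ _ Bx By; lra.
exists l, ((l + h) / 2); split; [lra|lra|lra|] => y yh.
constructor; last by apply: IH; lra.
by move=> By; apply: nB; exists y; split=> //; lra.
Qed.

Lemma exists_in_ray_avoiding (R : realType) (K : finType) (B : K -> R -> Prop)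
    (b : bool) :
  (forall k x y, B k x -> B k y -> x = y) ->
  exists2 x, in_ray b x & forall k, ~ B k x.
Proof.
move=> B1; pose lo : R := if b then 1 else - 2^-1; pose hi : R := if b then 2 else 0.
have lohi : lo < hi by rewrite /lo /hi; case: b {lo hi}; lra.
have [l [h [lol lh hhi avoid]]] := avoid_subsingletons (enum K) B1 lohi.
exists ((l + h) / 2).
  by move: lol hhi; rewrite /in_ray /lo /hi; case: b {lo hi lohi} => ? ?; lra.
have /avoid : l < (l + h) / 2 < h by lra.
move=> /List.Forall_forall F k; apply: F.
have : k \in enum K by rewrite mem_enum.
elim: (enum K) => //= k' ks IH; rewrite inE => /orP[/eqP ->|/IH]; by [left | right].
Qed.

Section GeneralPosition.
Variables (R : realType) (T : finType) (line : T -> 'I_3) (far : T -> bool).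
Implicit Types (t : T -> R) (a b c d e f v w : T).
Local Notation plane := (R * R)%type.
Local Notation pt := (vpoint line).
Local Notation seg t a b := (segment (pt t a) (pt t b)).

(** The set [s] holds the vertices already treated, for an induction that places one vertex at a
    time. Six distinct ends are the case to control, since edges sharing an end meet only there. *)
Definition no_three_concurrent t (s : {pred T}) := forall a b c d e f p,
  {subset [:: a; b; c; d; e; f] <= s} -> uniq [:: a; b; c; d; e; f] ->
  line a != line b -> line c != line d -> line e != line f ->
  seg t a b p -> seg t c d p -> seg t e f p -> False.

Lemma exists_configuration : exists t : T -> R, configuration far t.
Proof.
(* The offsets 2 and 3 make the inverses less than 1 and less than 1/2 already at rank 0. *)
exists (fun v => let r := (enum_rank v)%:R in
  if far v then 1 + (r + 2)^-1 else - (r + 3)^-1); split.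
  move=> v; set r : R := (enum_rank v)%:R.
  have r0 : 0 <= r by exact: ler0n.
  rewrite /in_ray; case: (far v).
    have h0 : 0 < (r + 2)^-1 by rewrite invr_gt0; lra.
    have h1 : (r + 2)^-1 < 1 by rewrite invf_lt1; lra.
    by lra.
  have h0 : 0 < (r + 3)^-1 by rewrite invr_gt0; lra.
  have h1 : (r + 3)^-1 < 2^-1 by rewrite ltf_pV2 ?posrE; lra.
  by lra.
move=> v w /=; set r : R := (enum_rank v)%:R; set r' : R := (enum_rank w)%:R.
have r0 : 0 <= r by exact: ler0n.
have r'0 : 0 <= r' by exact: ler0n.
have rr : r = r' -> v = w.
  by move/eqP; rewrite /r /r' eqr_nat => /eqP/val_inj/enum_rank_inj.
have h2 : 0 < (r + 2)^-1 by rewrite invr_gt0; lra.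
have h3 : 0 < (r + 3)^-1 by rewrite invr_gt0; lra.
have h2' : 0 < (r' + 2)^-1 by rewrite invr_gt0; lra.
have h3' : 0 < (r' + 3)^-1 by rewrite invr_gt0; lra.
case: (far v); case: (far w) => e; try (exfalso; lra); apply: rr.
- by move/addrI/invr_inj: e; lra.
- by move/oppr_inj/invr_inj: e; lra.
Qed.

Section Step.
Variables (t : T -> R) (v : T).
Hypothesis t_conf : configuration far t.

(** The index type is finite and lists every constraint on a new coordinate of [v]: coinciding with
    an old coordinate, or an edge at [v] passing through the intersection of two edges disjoint from
    it and from each other. *)
Definition bad_place (k : T + T * T * T * T * T) (x : R) : Prop :=
  match k with
  | inl w => x = t w
  | inr (b, c, d, e, f) =>
      [/\ uniq [:: v; b; c; d; e; f], line v != line b, line c != line d,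
          line e != line f &
          exists p, [/\ segment (x *: dir R (line v)) (pt t b) p,
            seg t c d p & seg t e f p]]
  end.

(** In the second case [cd] and [ef] meet in a single point, which does not depend on the coordinate
    of [v] and is not the point of [b]. The line from [b] through it meets the line of [v] only
    once. *)
Lemma bad_place_unique k x y : bad_place k x -> bad_place k y -> x = y.
Proof.
case: k => [w -> ->//|[[[[b c] d] e] f]] [U lvb lcd lef [p [pvb pcd pef]]].
move=> [_ _ _ _ [q [qvb qcd qef]]].
move: U; rewrite /= !inE !negb_or =>
  /and5P[_ /and4P[bc bd be bf] /and3P[cd ce cf] /andP[de df] /andP[ef _]].
have U4 : uniq [:: c; d; e; f] by rewrite /= !inE !negb_or cd ce cf de df ef.
have pq := edges_meet_once t_conf U4 lcd lef pcd pef qcd qef.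
rewrite -{q qcd qef}pq in qvb.
have pb : p <> pt t b.
  move=> pb; move: pcd; rewrite pb => /(vertex_on_edge t_conf lcd)[] /eqP; exact/negP.
move: pvb qvb => /segmentP[s [s0 s1]]; rewrite /vpoint /= /GRing.scale /= => e1 e2.
move=> /segmentP[u [u0 u1]]; rewrite /= /GRing.scale /= => f1 f2.
have [||g1 g2] := @dir_free R _ _ ((1 - s) * x) (s * t b) ((1 - u) * y) (u * t b) lvb.
- by transitivity p.1; [rewrite e1; ring | rewrite f1; ring].
- by transitivity p.2; [rewrite e2; ring | rewrite f2; ring].
have tb0 := in_ray_neq0 (proj1 t_conf b).
have su : s = u by apply: (mulIf tb0).
have s_neq1 : 1 - s != 0.
  apply/eqP => se; apply: pb; apply/plane_eqP.
  rewrite e1 e2 se /vpoint /= /GRing.scale /=.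
  have -> : s = 1 by lra.
  by split; ring.
by apply: (mulfI s_neq1); rewrite g1 su.
Qed.

Lemma add_general_vertex (s : {pred T}) : no_three_concurrent t s ->
  exists t', configuration far t' /\ no_three_concurrent t' [predU1 v & s].
Proof.
move=> gen; have [x xv x_ok] := exists_in_ray_avoiding (far v) bad_place_unique.
pose t' w := if w == v then x else t w.
have t'v : t' v = x by rewrite /t' eqxx.
have t'E w : w != v -> t' w = t w by rewrite /t' => /negbTE ->.
have pv : pt t' v = x *: dir R (line v) by rewrite /vpoint t'v.
have pE w : w != v -> pt t' w = pt t w by move=> wv; rewrite /vpoint t'E.
exists t'; split; first split.
- move=> w; have [->|wv] := eqVneq w v; first by rewrite t'v.
  by rewrite t'E //; exact: (proj1 t_conf).
- have tx w : x <> t w by move=> xw; exact: (x_ok (inl w)).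
  move=> w w'; have [->|wv] := eqVneq w v; have [->|wv'] := eqVneq w' v => //.
  + by rewrite t'v t'E // => /tx.
  + by rewrite t'v t'E // => /esym/tx.
  + by rewrite !t'E //; exact: (proj2 t_conf).
(* A new concurrency must use the moved vertex [v]. Here [v] is the first end of the first edge; the
   cases below bring its other five positions to this one by permuting edges and swapping ends. *)
have key b c d e f p : uniq [:: v; b; c; d; e; f] ->
    line v != line b -> line c != line d -> line e != line f ->
    seg t' v b p -> seg t' c d p -> seg t' e f p -> False.
  move=> U lvb lcd lef; have := U.
  rewrite cons_uniq !inE !negb_or => /andP[/and5P[vb vc vd ve vf] _].
  rewrite (pE b) 1?eq_sym // (pE c) 1?eq_sym // (pE d) 1?eq_sym // (pE e) 1?eq_sym //.
  rewrite (pE f) 1?eq_sym // => pvb pcd pef.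
  apply: (x_ok (inr (b, c, d, e, f))); split=> //; exists p; split=> //.
  by move: pvb; rewrite pv.
move=> a b c d e f p sub U lab lcd lef pab pcd pef.
have [va|va] := eqVneq a v.
  by rewrite va in U lab pab; apply: key U lab lcd lef pab pcd pef.
have [vb|vb] := eqVneq b v.
  apply: (key a c d e f p) => //; rewrite -?vb // 1?eq_sym 1?segmentC //.
  by rewrite -(perm_uniq (s1 := [:: a; b; c; d; e; f])) //; apply/permP => P /=; ring.
have [vc|vc] := eqVneq c v.
  apply: (key d a b e f p) => //; rewrite -?vc //.
  by rewrite -(perm_uniq (s1 := [:: a; b; c; d; e; f])) //; apply/permP => P /=; ring.
have [vd|vd] := eqVneq d v.
  apply: (key c a b e f p) => //; rewrite -?vd // 1?eq_sym 1?segmentC //.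
  by rewrite -(perm_uniq (s1 := [:: a; b; c; d; e; f])) //; apply/permP => P /=; ring.
have [ve|ve] := eqVneq e v.
  apply: (key f a b c d p) => //; rewrite -?ve //.
  by rewrite -(perm_uniq (s1 := [:: a; b; c; d; e; f])) //; apply/permP => P /=; ring.
have [vf|vf] := eqVneq f v.
  apply: (key e a b c d p) => //; rewrite -?vf // 1?eq_sym 1?segmentC //.
  by rewrite -(perm_uniq (s1 := [:: a; b; c; d; e; f])) //; apply/permP => P /=; ring.
move: pab pcd pef; rewrite !pE //; apply: gen => // w wl.
have := sub w wl; rewrite !inE => /orP[/eqP wv|//].
by move: wl; rewrite wv !inE ![v == _]eq_sym (negbTE va) (negbTE vb) (negbTE vc)
  (negbTE vd) (negbTE ve) (negbTE vf).
Qed.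

End Step.

Lemma exists_general_configuration :
  exists t, configuration far t /\ no_three_concurrent t predT.
Proof.
have [t [t_conf gen]] : exists t,
    configuration far t /\ no_three_concurrent t (mem (enum T)).
  elim: (enum T) => [|v s [t [t_conf gen]]].
    have [t t_conf] := exists_configuration; exists t; split=> // a b c d e f p sub.
    by have := sub a (mem_head _ _).
  have [t' [t'_conf gen']] := add_general_vertex v t_conf gen.
  by exists t'.
exists t; split=> // a b c d e f p _; apply: gen => w _.
by have : w \in enum T by rewrite mem_enum.
Qed.

End GeneralPosition.

(** * Crossings and quadruples *)

Lemma set2_eqP (T : finType) (a b c d : T) : [set a; b]%SET = [set c; d]%SET ->
  (a = c /\ b = d) \/ (a = d /\ b = c).
Proof.
move=> E; have := set21 a b; have := set22 a b; have := set21 c d; have := set22 c d.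
rewrite -{1 2}E {3 4}E !in_set2.
by do 4![case/orP => /eqP ?]; subst; auto.
Qed.

Section Crossings.
Variables (R : realType) (T : finType) (line : T -> 'I_3) (far : T -> bool).
Variable t : T -> R.
Hypothesis t_conf : configuration far t.
Implicit Types (a b c d : T).
Local Notation seg a b := (segment (vpoint line t a) (vpoint line t b)).

Definition crossing a b c d p := [/\ uniq [:: a; b; c; d], line a != line b,
  line c != line d, seg a b p & seg c d p].

Lemma crossingC a b c d p : crossing a b c d p -> crossing c d a b p.
Proof.
move=> [U ab cd pab pcd]; split=> //.
by rewrite (uniq_catC [:: c; d] [:: a; b]).
Qed.

Lemma crossing_swapr a b c d p : crossing a b c d p -> crossing a b d c p.
Proof.
move=> [U ab cd pab pcd]; split; rewrite // 1?eq_sym 1?segmentC //.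
by rewrite -(perm_uniq (s1 := [:: a; b; c; d])) //; apply/permP => P /=; ring.
Qed.

Lemma crossing_swapl a b c d p : crossing a b c d p -> crossing b a c d p.
Proof. by move=> /crossingC/crossing_swapr/crossingC. Qed.

(** Each of the four possible coincidences of ends would make the edges incident, and by
    [edges_incident] incident edges share no point besides their common vertex. *)
Lemma crossing_edges a b c d p : line a != line b -> line c != line d ->
  [set a; b]%SET != [set c; d]%SET -> ~ range (vpoint line t) p ->
  seg a b p -> seg c d p -> crossing a b c d p.
Proof.
move=> ab cd abcd nv pab pcd; split=> //.
have nvp v : p <> vpoint line t v by move=> pv; apply: nv; exists v.
have incident x y z : line x != line y -> line x != line z ->
    [set x; y]%SET != [set x; z]%SET -> seg x y p -> seg x z p -> False.
  move=> xy xz ne pxy pxz; apply: (nvp x); apply: (edges_incident t_conf _ xy xz pxy pxz).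
  by apply: contraNneq ne => ->.
have ab' : a != b by apply: contraNneq ab => ->.
have cd' : c != d by apply: contraNneq cd => ->.
have E x y : [set x; y]%SET = [set y; x]%SET by rewrite finset.setUC.
rewrite eq_sym in cd; rewrite segmentC in pcd.
have ne1 := abcd; rewrite [X in _ != X]E in ne1.
have ba := ab; have pba := pab; rewrite eq_sym in ba; rewrite segmentC in pba.
have ne2 := abcd; rewrite E in ne2; have ne3 := ne1; rewrite E in ne3.
have dc := cd; rewrite eq_sym in dc; have pdc := pcd; rewrite segmentC in pdc.
rewrite /= !inE !negb_or ab' cd' /= !andbT.
apply/andP; split; apply/andP; split; apply/eqP => e.
- by rewrite -e in abcd dc pdc; exact: (incident a b d).
- by rewrite -e in ne1 cd pcd; exact: (incident a b c).
- by rewrite -e in ne2 dc pdc; exact: (incident b a d).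
- by rewrite -e in ne3 cd pcd; exact: (incident b a c).
Qed.

Lemma crossing_two_matchings a b c d p q :
  crossing a b c d p -> crossing a c b d q -> False.
Proof.
move=> [U ab cd pab pcd] [_ ac bd qac qbd].
exact: (edges_one_matching t_conf U ab cd ac pab pcd qac qbd).
Qed.

Lemma crossing_unique a b c d p q :
  crossing a b c d p -> crossing a b c d q -> p = q.
Proof.
move=> [U ab cd pab pcd] [_ _ _ qab qcd].
exact: (edges_meet_once t_conf U ab cd pab pcd qab qcd).
Qed.

(** Each crossing splits its four vertices into two edges. Equal splittings give equal points, and
    different splittings cannot both cross. *)
Lemma crossing_determined a b c d a' b' c' d' p q :
  crossing a b c d p -> crossing a' b' c' d' q ->
  [:: a; b; c; d] =i [:: a'; b'; c'; d'] -> p = q.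
Proof.
move=> P Q E.
(* By the symmetries of [crossing], the second crossing may be assumed to start with [a]. *)
have {a' b' c' d' Q E} [b' [c' [d' [Q E]]]] : exists b' c' d',
    crossing a b' c' d' q /\ [:: a; b; c; d] =i [:: a; b'; c'; d'].
  have : a \in [:: a'; b'; c'; d'] by rewrite -E mem_head.
  rewrite !inE => /or4P[] /eqP e; subst.
  - by exists b', c', d'.
  - exists a', c', d'; split; first exact: crossing_swapl.
    by move=> x; rewrite E !inE orbCA.
  - exists d', a', b'; split; first exact: crossingC.
    by move=> x; rewrite E !inE; do 4!case: eqP.
  - exists c', a', b'; split; first exact/crossing_swapl/crossingC.
    by move=> x; rewrite E !inE; do 4!case: eqP.
have [UP _ _ _ _] := P; have [UQ _ _ _ _] := Q.
have in_bcd x : x \in [:: b'; c'; d'] -> x \in [:: b; c; d].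
  move=> xQ; have : x \in [:: a; b; c; d] by rewrite E inE xQ orbT.
  rewrite inE => /orP[/eqP xa|//].
  by move: UQ; rewrite cons_uniq -xa xQ.
have := in_bcd b'; have := in_bcd c'; have := in_bcd d'.
rewrite !inE !eqxx ?orbT => /(_ isT)/or3P Hd /(_ isT)/or3P Hc /(_ isT)/or3P Hb.
move: UQ; rewrite /= !inE !negb_or => /and4P[_ /andP[bc bd] cd _].
have P' := crossing_swapr P; have Q' := crossing_swapr Q.
(* Six bijections remain: two keep the partner of [a], and the other four contradict
   [crossing_two_matchings]. *)
by case: Hb => /eqP eb; case: Hc => /eqP ec; case: Hd => /eqP ed; subst;
  rewrite ?eqxx // in bc bd cd;
  first [ exact: crossing_unique P Q | exact: crossing_unique P Q'
        | case: (crossing_two_matchings P Q) | case: (crossing_two_matchings P Q')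
        | case: (crossing_two_matchings P' Q) | case: (crossing_two_matchings P' Q')].
Qed.

Lemma crossing_quadruple_same a b c d p : crossing a b c d p -> line a = line c ->
  [set a; c]%SET :|: [set b; d]%SET \in quadruples line far.
Proof.
move=> [U ab cd pab pcd] ac.
have [nac nbd] : a != c /\ b != d.
  by move: U; rewrite /= !inE !negb_or => /and4P[/and3P[_ -> _] /andP[_ ->]].
have [bd|bd] := eqVneq (line b) (line d).
  have [fac fbd] := crossing_two_lines t_conf nac nbd ab (esym ac) (esym bd) pab pcd.
  apply: (fintype.subsetP (two_line_quadruples_sub line far ab)).
  by apply: imset2_f; apply: ray_pairs_set2.
have ad : line a != line d by rewrite ac.
have [fac fbd] := crossing_three_lines t_conf nac ab ad bd (esym ac) pab pcd.
apply: (fintype.subsetP (three_line_quadruples_sub line far ab ad bd)).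
by apply: imset2_f; [apply: ray_pairs_set2 | apply: opposite_pairs_set2].
Qed.

(** Four vertices on three lines have two on the same line. These are ends of different edges, so
    relabelling reduces to [crossing_quadruple_same]. *)
Lemma crossing_quadruple a b c d p : crossing a b c d p ->
  [set x in [:: a; b; c; d]]%SET \in quadruples line far.
Proof.
move=> P; have [U ab cd _ _] := P.
have key a' b' c' d' : crossing a' b' c' d' p -> line a' = line c' ->
    [:: a; b; c; d] =i [:: a'; b'; c'; d'] ->
    [set x in [:: a; b; c; d]]%SET \in quadruples line far.
  move=> P' ac' E; rewrite (_ : [set x in _]%SET = [set a'; c'] :|: [set b'; d'])%SET.
    exact: crossing_quadruple_same P' ac'.
  by apply/setP => x; rewrite finset.inE E !inE; do 4!case: eqP.
have [ac|ac] := eqVneq (line a) (line c); first exact: (key a b c d).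
have [ad|ad] := eqVneq (line a) (line d).
  apply: (key a b d c) => //; first exact: crossing_swapr.
  by move=> x; rewrite !inE; do 4!case: eqP.
have [bc|bc] := eqVneq (line b) (line c).
  apply: (key b a c d) => //; first exact: crossing_swapl.
  by move=> x; rewrite !inE; do 4!case: eqP.
have [bd|bd] := eqVneq (line b) (line d).
  apply: (key b a d c) => //; first exact/crossing_swapl/crossing_swapr.
  by move=> x; rewrite !inE; do 4!case: eqP.
exfalso; move: ab cd ac ad bc bd.
by have [->|->|->] := ord3P (line a); have [->|->|->] := ord3P (line b);
  have [->|->|->] := ord3P (line c); have [->|->|->] := ord3P (line d);
  rewrite ?eqxx.
Qed.

End Crossings.

(** * The straight-line drawing *)

Lemma crossing_number_le_rectilinear (R : realType) (G : sgraph) :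
  (crossing_number R G <= rectilinear_crossing_number R G)%E.
Proof.
by apply: ereal_inf_le_tmp; apply: image_subset => k [D [gD _ cD]]; exists D.
Qed.

Section StraightDrawing.
Variables (R : realType) (n1 n2 n3 : nat).
Local Notation G := (complete_tripartite n1 n2 n3).
Local Notation line := (@part n1 n2 n3).
Local Notation far := (@tripartite_far n1 n2 n3).
Variable t : tripartite_vertex n1 n2 n3 -> R.
Hypothesis t_conf : configuration far t.
Hypothesis t_gen : no_three_concurrent line t predT.
Local Notation place := (vpoint line t).
Local Notation seg a b := (segment (place a) (place b)).

(** An edge is an unordered set, and quantifying over its ends avoids choosing an order for them. *)
Definition straight_curve (f : {set G}) : set (R * R) :=
  [set p | exists u v : G, [/\ f = [set u; v]%SET, adj u v & seg u v p]].

Lemma straight_curveE (u v : G) : adj u v ->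
  straight_curve [set u; v]%SET = seg u v.
Proof.
move=> uv; rewrite eqEsubset;
  split=> [p [u' [v' [/set2_eqP[[-> ->]|[-> ->]] _ pu]]]|p pu].
- by [].
- by rewrite segmentC.
- by exists u, v.
Qed.

Lemma straight_curve_arc (u v : G) : adj u v ->
  simple_arc (straight_curve [set u; v]%SET) (place u) (place v).
Proof.
move=> uv; rewrite straight_curveE //; apply: segment_simple_arc.
by move=> /(vpoint_inj t_conf) e; rewrite e adj_irrefl in uv.
Qed.

Lemma straight_curve_vertex (f : {set G}) (w : G) :
  f \in edges G -> straight_curve f (place w) -> w \in f.
Proof.
move=> _ [u [v [-> uv /(vertex_on_edge t_conf uv)]]].
by case=> ->; rewrite !inE eqxx ?orbT.
Qed.

Definition straight_drawing : drawing R G :=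
  @Drawing R G place straight_curve (@vpoint_inj R _ line far t t_conf)
    straight_curve_arc straight_curve_vertex.

Lemma straight_drawing_rectilinear : rectilinear straight_drawing.
Proof. by move=> u v uv; exact: straight_curveE. Qed.

Lemma straight_crossing (f g : {set G}) p : f \in edges G -> g \in edges G ->
  f != g -> ~ range place p -> straight_curve f p -> straight_curve g p ->
  exists a b c d, [/\ f = [set a; b]%SET, g = [set c; d]%SET & crossing line t a b c d p].
Proof.
move=> _ _ fg pv [a [b [fE ab pab]]] [c [d [gE cd pcd]]].
exists a, b, c, d; split=> //; apply: (crossing_edges t_conf) => //.
by move: fg; rewrite fE gE.
Qed.

Lemma crosses_at_mem (A B : set (R * R)) p : crosses_at A B p -> A p /\ B p.
Proof.
by move=> [U [h [[_ Up] hp _ hA hB]]]; split; [apply/hA | apply/hB]; rewrite // hp.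
Qed.

Lemma straight_drawing_good : good straight_drawing.
Proof.
split.
- move=> f g h p _ _ _ pv [a [b [fE ab pab]]] [c [d [gE cd pcd]]] [e [k [hE ek pek]]].
  have [?|fg] := eqVneq f g; first by constructor 1.
  have [?|gh] := eqVneq g h; first by constructor 2.
  have [?|fh] := eqVneq f h; first by constructor 3.
  exfalso.
  have [U1 _ _ _ _] : crossing line t a b c d p.
    by apply: (crossing_edges t_conf) => //; move: fg; rewrite fE gE.
  have [U2 _ _ _ _] : crossing line t c d e k p.
    by apply: (crossing_edges t_conf) => //; move: gh; rewrite gE hE.
  have [U3 _ _ _ _] : crossing line t a b e k p.
    by apply: (crossing_edges t_conf) => //; move: fh; rewrite fE hE.
  (* Pairwise crossing makes the six ends distinct, as general position requires. *)
  apply: (t_gen _ _ ab cd ek pab pcd pek) => //.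
  move: U1 U2 U3; rewrite /= !inE !negb_or.
  move=> /and4P[/and3P[-> -> ->] /andP[-> ->] -> _].
  move=> /and4P[/and3P[_ -> ->] /andP[-> ->] -> _].
  by move=> /and4P[/and3P[_ -> ->] /andP[-> ->] _ _].
- move=> f g p fE gE fg fg0 [pv cp].
  have [pf pg] := crosses_at_mem cp.
  have [a [b [c [d [fab gcd [U _ _ _ _]]]]]] := straight_crossing fE gE fg pv pf pg.
  case/finset.set0Pn: fg0 => x; rewrite fab gcd !inE => /andP[xab xcd].
  move: U; rewrite (cat_uniq [:: a; b] [:: c; d]) => /and3P[_ /hasPn/= H _].
  by have := H x; rewrite !inE xcd xab => /(_ isT).
- move=> f g p q fE gE fg [pv cp] [qv cq].
  have [pf pg] := crosses_at_mem cp; have [qf qg] := crosses_at_mem cq.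
  have [a [b [c [d [fab gcd P]]]]] := straight_crossing fE gE fg pv pf pg.
  have [U ab cd _ _] := P; rewrite /= fab gcd !straight_curveE // in qf qg.
  by apply: (crossing_unique t_conf P).
- move=> f g p fE gE fg pv pf pg; split=> //=.
  have [a [b [c [d [fab gcd [U ab cd pab pcd]]]]]] := straight_crossing fE gE fg pv pf pg.
  rewrite fab gcd !straight_curveE //.
  have pvx x : p <> place x by move=> px; apply: pv; exists x.
  by apply: segments_crosses_at => //; exact: (edges_transversal t_conf U ab cd pab pcd).
Qed.

Lemma straight_drawing_crossings :
  (crossings straight_drawing #<= `I_(#|quadruples line far|))%card.
Proof.
pose F := enum (quadruples line far).
pose at_quad (S : {set tripartite_vertex n1 n2 n3}) p := exists a b c d,
  S = [set x in [:: a; b; c; d]]%SET /\ crossing line t a b c d p.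
(* [g] sends the index of a quadruple to its crossing point, with [(0, 0)] as default if there is
   none. By [crossing_determined] this choice hits every crossing. *)
pose g k := xget (0, 0) (at_quad (nth finset.set0 F k)).
suff sub : crossings straight_drawing `<=` g @` `I_(#|quadruples line far|).
  exact: card_le_trans (subset_card_le sub) (card_image_le _ _).
move=> p [pv [f [h [fE hE fh pf ph]]]].
have [a [b [c [d [fab hcd P]]]]] := straight_crossing fE hE fh pv pf ph.
have SF := crossing_quadruple t_conf P.
set S := [set x in [:: a; b; c; d]]%SET in SF.
have SF' : S \in F by rewrite mem_enum.
exists (index S F); first by rewrite /= cardE index_mem.
rewrite /g nth_index //; case: xgetP => [q _ [a' [b' [c' [d' [SE Q]]]]]|].
  apply: (crossing_determined t_conf Q P) => x.
  by have /setP/(_ x) := SE; rewrite !inE => <-.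
by move=> /(_ p); case; exists a, b, c, d.
Qed.

End StraightDrawing.

Theorem theorem1p1 (R : realType) (n1 n2 n3 : nat)
    (hn1 : (1 <= n1)%N) (hn2 : (1 <= n2)%N) (hn3 : (1 <= n3)%N) :
  (crossing_number R (complete_tripartite n1 n2 n3)
     <= rectilinear_crossing_number R (complete_tripartite n1 n2 n3))%E /\
  (rectilinear_crossing_number R (complete_tripartite n1 n2 n3)
     <= ((A n1 n2 n3)%:R)%:E)%E.
Proof.
split; first exact: crossing_number_le_rectilinear.
have [t [t_conf t_gen]] :=
  exists_general_configuration R (@part n1 n2 n3) (@tripartite_far n1 n2 n3).
have le_quad := straight_drawing_crossings t_conf.
(* The bound by a finite set of quadruples makes the crossing set finite, so its size [k] is one of
   the values over which the rectilinear minimum is taken. *)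
have [k kE] : exists k, (crossings (straight_drawing t_conf) #= `I_k)%card.
  by apply/finite_setP/(card_le_finite le_quad)/finite_II.
have kA : (k <= A n1 n2 n3)%N.
  apply: leq_trans (card_tripartite_quadruples n1 n2 n3).
  by rewrite -card_le_II -(card_le_eql kE).
apply: (@le_trans _ _ (k%:R)%:E); last by rewrite lee_fin ler_nat.
apply: ereal_inf_lbound; exists k => //; exists (straight_drawing t_conf); split=> //.
- exact: straight_drawing_good.
- exact: straight_drawing_rectilinear.
Qed.
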